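(* Let $X$ be an arbitrary subset of $\omega$, and let $A=(a_{nk})_{n,k\ge1}$ and $G=(g_{nk})_{n,k\ge1}$ be infinite matrices with $$g_{nk}=\sum_{j=1}^n j^{-1}a_{jk}\qquad\text{for all } n,k\in\mathbb{N}.$$ Then: (i) $A\in(X:c_0(\Gamma))$ if and only if $G\in(X:c_0)$. (ii) $A\in(X:c(\Gamma))$ if and only if $G\in(X:c)$. (iii) $A\in(X:\ell_\infty(\Gamma))$ if and only if $G\in(X:\ell_\infty)$.
   Context: $\omega$ is the space of all real (or complex) sequences $x=(x_k)_{k\ge1}$; $\ell_\infty$, $c$, $c_0$ are the spaces of bounded, convergent and null sequences. The infinite matrix $\Gamma=(b_{nk})_{n,k\ge1}$ has $b_{nk}=1/k$ for $1\le k\le n$ and $b_{nk}=0$ for $k>n$, so $(\Gamma x)_n=\sum_{k=1}^n k^{-1}x_k$, and for $Z\in\{\ell_\infty,c,c_0\}$, $Z(\Gamma)=\{x\in\omega:\Gamma x\in Z\}$. $(X:Y)$ denotes the class of infinite matrices $A=(a_{nk})$ such that for every $x\in X$ the series $(Ax)_n=\sum_k a_{nk}x_k$ converges for every $n$ and $Ax=((Ax)_n)_n\in Y$. *)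

(* Defs.v *)
From HB Require Import structures.
From mathcomp Require Import all_boot all_order all_algebra.
From mathcomp Require Import boolp classical_sets functions reals.
From mathcomp Require Import topology normedtype sequences.

Set Implicit Arguments.
Unset Strict Implicit.
Unset Printing Implicit Defensive.

Import Order.TTheory GRing.Theory Num.Theory.
Import numFieldNormedType.Exports.
Local Open Scope classical_set_scope.
Local Open Scope ring_scope.

(* The scalars are an arbitrary [K : numFieldType] with the topology of its
   norm; the real and the complex case are K = R and K = R[i], R : realType.

   Sequences and matrices are indexed from 0: the term [x k] stands for the
   mathematical x_(k+1), and the entry [A n k] for a_(n+1,k+1). *)

Definition omega (K : numFieldType) : Type := nat -> K.

Definition infmx (K : numFieldType) : Type := nat -> nat -> K.

Definition ell_infty (K : numFieldType) : set (omega K) :=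
  [set x | bounded_fun (x : nat -> K)].

Definition conv_seq (K : numFieldType) : set (omega K) :=
  [set x | cvgn (x : nat -> K)].

Definition null_seq (K : numFieldType) : set (omega K) :=
  [set x | (x : nat -> K) @ \oo --> (0 : K)].

Arguments ell_infty K : clear implicits.
Arguments conv_seq K : clear implicits.
Arguments null_seq K : clear implicits.

Definition row_terms (K : numFieldType) (A : infmx K) (x : omega K) (n : nat) :
  nat -> K := fun k => A n k * x k.

(* [limn] is total, so this is meaningful only when the row series converge. *)
Definition mx_transform (K : numFieldType) (A : infmx K) (x : omega K) :
  omega K := fun n => limn (series (row_terms A x n)).

Definition mx_domain (K : numFieldType) (A : infmx K) (Z : set (omega K)) :
  set (omega K) :=
  [set x | (forall n, cvgn (series (row_terms A x n))) /\
           Z (mx_transform A x)].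

(* The class (X : Y). *)
Definition mx_class (K : numFieldType) (X Y : set (omega K)) :
  set (infmx K) :=
  [set A | forall x, X x ->
     (forall n, cvgn (series (row_terms A x n))) /\ Y (mx_transform A x)].

Definition Gamma (K : numFieldType) : infmx K :=
  fun n k => if (k <= n)%N then k.+1%:R^-1 else 0.

Arguments Gamma K : clear implicits.

(* Main.v *)
Require Import Defs.
From HB Require Import structures.
From mathcomp Require Import all_boot all_order all_algebra.
From mathcomp Require Import boolp classical_sets functions reals.
From mathcomp Require Import topology normedtype sequences.

Set Implicit Arguments.
Unset Strict Implicit.
Unset Printing Implicit Defensive.

Import Order.TTheory GRing.Theory Num.Theory.
Import numFieldNormedType.Exports.
Local Open Scope classical_set_scope.
Local Open Scope ring_scope.

(** Row [n] of [G] is a finite combination of rows [0..n] of [A], so [G] is the product of [Gamma]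
    and [A]. Finite sums commute with limits, hence [G x] and [Gamma (A x)] are the same sequence
    once the row series of [A] at [x] converge. Since [Gamma] is triangular with nonzero diagonal,
    the relation inverts, and the row series of [A] converge exactly when those of [G] do
    ([cvg_series_sum], [cvgn_series_diff]). The target space enters only through membership of this
    common sequence, so [mx_class_Gamma] treats any [Z]. *)

Lemma cvg_series_Gamma (K : numFieldType) (y : omega K) (n : nat) :
  series (row_terms (Gamma K) y n) @ \oo -->
    \sum_(j < n.+1) j.+1%:R^-1 * y j.
Proof.
(* Row [n] of [Gamma] vanishes beyond column [n], so the shifted partial sums are constant. *)
rewrite -(cvg_shiftn n.+1).
have -> : (fun m => series (row_terms (Gamma K) y n) (m + n.+1)%N) =
          cst (\sum_(j < n.+1) j.+1%:R^-1 * y j).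
  apply/funext => m /=.
  rewrite /series /= (@big_cat_nat _ _ _ n.+1) ?leq_addl //= big_mkord.
  rewrite [X in _ + X]big_nat [X in _ + X]big1 => [|k /andP[nk _]]; last first.
    by rewrite /row_terms /Gamma leqNgt nk mul0r.
  rewrite addr0; apply: eq_bigr => j _.
  by rewrite /row_terms /Gamma -ltnS ltn_ord.
exact: cvg_cst.
Qed.

Lemma mx_transform_Gamma (K : numFieldType) (y : omega K) (n : nat) :
  mx_transform (Gamma K) y n = \sum_(j < n.+1) j.+1%:R^-1 * y j.
Proof. exact/cvg_lim/cvg_series_Gamma. Qed.

Lemma mx_domain_Gamma (K : numFieldType) (Z : set (omega K)) (y : omega K) :
  mx_domain (Gamma K) Z y <-> Z (mx_transform (Gamma K) y).
Proof.
split=> [[]//|Zy]; split=> // n.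
by apply/cvg_ex; eexists; exact: cvg_series_Gamma.
Qed.

Section weighted_partial_sums.
Context (K : numFieldType) (A G : infmx K).
Hypothesis hG : forall n k : nat, G n k = \sum_(j < n.+1) j.+1%:R^-1 * A j k.

(** An interchange of two finite sums: working with partial sums avoids any convergence assumption,
    so the identity serves both directions. *)
Lemma series_row_terms_sum (x : omega K) (n m : nat) :
  series (row_terms G x n) m =
  \sum_(j < n.+1) j.+1%:R^-1 * series (row_terms A x j) m.
Proof.
rewrite /series /=.
under [RHS]eq_bigr do rewrite mulr_sumr.
rewrite exchange_big; apply: eq_bigr => k _.
by rewrite /row_terms hG mulr_suml; apply: eq_bigr => j _; rewrite mulrA.
Qed.

Lemma cvg_series_sum (x : omega K) (n : nat) :
  (forall j, cvgn (series (row_terms A x j))) ->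
  series (row_terms G x n) @ \oo -->
    \sum_(j < n.+1) j.+1%:R^-1 * mx_transform A x j.
Proof.
move=> cA; rewrite (funext (series_row_terms_sum x n)).
apply: cvg_big => [|j _]; first exact: add_continuous.
by apply: cvgM; [exact: cvg_cst | exact: cA].
Qed.

(* Telescoping recovers a_{nk} = n (g_{nk} - g_{n-1,k}) on the row series. *)
Lemma cvgn_series_diff (x : omega K) :
  (forall n, cvgn (series (row_terms G x n))) ->
  forall n, cvgn (series (row_terms A x n)).
Proof.
move=> cG [|n].
  suff -> : series (row_terms A x 0) = series (row_terms G x 0) by [].
  by apply/funext => m; rewrite series_row_terms_sum big_ord1 invr1 mul1r.
(* With indices from 0, row [n.+1] carries the weight [n.+2%:R^-1], which the factor [n.+2%:R]
   cancels. *)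
suff -> : series (row_terms A x n.+1) = fun m => n.+2%:R *
    (series (row_terms G x n.+1) m - series (row_terms G x n) m).
  by apply: is_cvgM; [exact: is_cvg_cst | exact: is_cvgB].
apply/funext => m; rewrite !series_row_terms_sum big_ord_recr /= addrAC subrr.
by rewrite add0r mulVKf // pnatr_eq0.
Qed.

Lemma mx_class_Gamma (X Z : set (omega K)) :
  mx_class X (mx_domain (Gamma K) Z) A <-> mx_class X Z G.
Proof.
(* Convergence is assumed for [A]; when starting from [G], it is first recovered by
   [cvgn_series_diff]. *)
have GA x : (forall n, cvgn (series (row_terms A x n))) ->
    mx_transform G x = mx_transform (Gamma K) (mx_transform A x).
  move=> cA; apply/funext => n; rewrite mx_transform_Gamma.
  exact/cvg_lim/cvg_series_sum.
split=> H x /H[].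
  move=> cA /mx_domain_Gamma ZA; split; last by rewrite GA.
  by move=> n; apply/cvg_ex; eexists; exact: cvg_series_sum.
move=> /cvgn_series_diff cA ZG; split=> //.
by apply/mx_domain_Gamma; rewrite -GA.
Qed.

End weighted_partial_sums.

Theorem theorem4p4 (K : numFieldType) (X : set (omega K)) (A G : infmx K)
    (hG : forall n k : nat, G n k = \sum_(j < n.+1) j.+1%:R^-1 * A j k) :
  [/\ mx_class X (mx_domain (Gamma K) (null_seq K)) A <->
        mx_class X (null_seq K) G,
      mx_class X (mx_domain (Gamma K) (conv_seq K)) A <->
        mx_class X (conv_seq K) G
    & mx_class X (mx_domain (Gamma K) (ell_infty K)) A <->
        mx_class X (ell_infty K) G].
Proof. by split; exact: mx_class_Gamma. Qed.
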